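(* Let $p\ge 1$, $\mathbf{s}=(s_1,\dots,s_p)\in\mathbb{N}^p$ and $\mathbf{x}=(x_1,\dots,x_p)\in\mathbb{C}^p$. Set $$f^{(\mathbf{s})}(\mathbf{x},t):=\prod_{\mathbf{k}\in\mathbb{N}^p}\left(1-\mathbf{x}^{\mathbf{k}}t\right)^{-\binom{\mathbf{s}}{\mathbf{k}}(-1)^{\mathbf{k}}},\qquad \mathbf{x}^{\mathbf{k}}:=\prod_{j=1}^p x_j^{k_j},\qquad \binom{\mathbf{s}}{\mathbf{k}}(-1)^{\mathbf{k}}:=\prod_{j=1}^p\binom{s_j}{k_j}(-1)^{k_j}.$$ Then for every $n\in\mathbb{N}$, $$\mathbb{E}\left[Z_n^{\mathbf{s}}(\mathbf{x})\right]=\left[f^{(\mathbf{s})}(\mathbf{x},t)\right]_n .$$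
   Context: $\mathbb{N}=\{0,1,2,\dots\}$. For $n\ge1$, $S_n$ is identified with the group of $n\times n$ permutation matrices $g=(\delta_{i,\sigma(j)})_{1\le i,j\le n}$, $\sigma$ a permutation of $\{1,\dots,n\}$. For $g\in S_n$ one sets $Z_n^{\mathbf{s}}(\mathbf{x})(g):=\prod_{k=1}^p\det(I-x_kg)^{s_k}$. $\mathbb{E}$ is expectation with respect to the uniform measure on $S_n$; by convention $\mathbb{E}[Z_0^{\mathbf{s}}(\mathbf{x})]:=1$. The product defining $f^{(\mathbf{s})}$ has only finitely many nontrivial factors, since $\binom{s_j}{k_j}=0$ for $k_j>s_j$. $[f(t)]_n$ denotes the coefficient of $t^n$ in the power series expansion of $f$ at $t=0$. *)

(* Defs.v *)
From HB Require Import structures.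
From mathcomp Require Import all_boot all_order all_algebra all_fingroup.
From mathcomp Require Import all_classical all_reals all_analysis.
From mathcomp Require Import complex.
Set Implicit Arguments.
Unset Strict Implicit.
Unset Printing Implicit Defensive.
Import Order.TTheory GRing.Theory Num.Theory.
Import numFieldNormedType.Exports.
Local Open Scope classical_set_scope.
Local Open Scope ring_scope.

(* The entry (i, j) is the Kronecker delta of i and sigma j.  MathComp's      *)
(* [perm_mx] is the transpose of this matrix.                                 *)
Definition perm_matrix (C : numFieldType) (n : nat) (sigma : 'S_n) : 'M[C]_n :=
  \matrix_(i < n, j < n) (i == sigma j)%:R.

Definition Zprod (C : numFieldType) (p : nat) (s : 'I_p -> nat) (x : 'I_p -> C)
    (n : nat) (sigma : 'S_n) : C :=
  \prod_(k < p) \det (1%:M - x k *: perm_matrix C sigma) ^+ s k.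

(* For n = 0, ['S_0] has one element and the determinant of the empty matrix  *)
(* is 1, so [expect_Sn (Zprod s x (n := 0))] is the conventional value 1.     *)
Definition expect_Sn (C : numFieldType) (n : nat) (F : 'S_n -> C) : C :=
  (\sum_(sigma : 'S_n) F sigma) / #|{: 'S_n}|%:R.

Definition mpow (C : numFieldType) (p : nat) (x : 'I_p -> C)
    (k : {ffun 'I_p -> nat}) : C :=
  \prod_(j < p) x j ^+ k j.

Definition signed_mbin (p : nat) (s : 'I_p -> nat) (k : {ffun 'I_p -> nat})
    : int :=
  \prod_(j < p) ('C(s j, k j)%:Z * (-1) ^+ k j).

(* The product ranges over all of N^p: [\big[_/_]_(_ \in _)] is the product   *)
(* over the factors different from 1, of which there are finitely many here   *)
(* because the exponent vanishes as soon as [k j > s j] for some [j].         *)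
Definition fgen (C : numFieldType) (p : nat) (s : 'I_p -> nat) (x : 'I_p -> C)
    (t : C) : C :=
  \big[*%R/1]_(k \in [set: {ffun 'I_p -> nat}])
    (1 - mpow x k * t) ^ (- signed_mbin s k).

Definition power_expansion0 (C : numFieldType) (f : C -> C) (a : nat -> C)
    : Prop :=
  \forall t \near (0 : C), [series a k * t ^+ k]_k @ \oo --> f t.

(* The default 0 is only used when [f] has no power series expansion at 0;    *)
(* by [taylor_coefE] below, [taylor_coef f] is otherwise its only expansion.  *)
Definition taylor_coef (C : numFieldType) (f : C -> C) (n : nat) : C :=
  xget (fun=> 0) [set a | power_expansion0 f a] n.

Lemma power_expansion0_unique (C : numFieldType) (f : C -> C)
  (a b : nat -> C) :
  power_expansion0 f a -> power_expansion0 f b -> a = b.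
Proof.
move=> fa fb; pose d k := a k - b k.
have hd : \forall t \near (0 : C), [series d k * t ^+ k]_k @ \oo --> (0 : C).
  near=> t.
  have ha : [series a k * t ^+ k]_k @ \oo --> f t by near: t.
  have hb : [series b k * t ^+ k]_k @ \oo --> f t by near: t.
  rewrite -(subrr (f t)).
  have -> : [series d k * t ^+ k]_k
          = [series a k * t ^+ k]_k - [series b k * t ^+ k]_k.
    apply/funext => N; rewrite /series /= !fctE /= -sumrB.
    by apply: eq_bigr => i _; rewrite mulrBl.
  exact: cvgB.
have [e /= e0 he] := (nbhs_ballP _ _).1 hd.
pose s : C := e / 2.
have s0 : 0 < s by rewrite divr_gt0.
have hs (t : C) : `|t| <= s -> [series d k * t ^+ k]_k @ \oo --> (0 : C).
  move=> ht; apply: he; rewrite /ball /= sub0r normrN.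
  by apply: (le_lt_trans ht); rewrite /s ltr_pdivrMr // ltr_pMr // ltr1n.
have [M M0 hM] : exists2 M : C, 0 < M & forall k, `|d k * s ^+ k| <= M.
  have ht0 : (fun k => d k * s ^+ k) @ \oo --> (0 : C).
    apply: cvg_series_cvg_0; apply/cvg_ex; exists 0; apply: hs.
    by rewrite gtr0_norm.
  have [N _ hN] := (cvgr0Pnorm_le _).1 ht0 1 ltr01.
  exists (1 + \sum_(k < N) `|d k * s ^+ k|).
    by rewrite ltr_pwDl // sumr_ge0.
  move=> k; have [kN|Nk] := ltnP k N.
    rewrite (bigD1 (Ordinal kN)) //= addrCA lerDl addr_ge0 // sumr_ge0 //.
  by apply: (le_trans (hN k Nk)); rewrite lerDl sumr_ge0.
suff d0 n : d n = 0.
  by apply/funext => n; apply/eqP; rewrite -subr_eq0; apply/eqP/d0.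
elim/ltn_ind: n => n IH.
have main (q : C) : 0 < q -> q <= 2^-1 -> `|d n * s ^+ n| <= 3 * M * q.
  move=> q0 q2.
  have q1 : q <= 1 by rewrite (le_trans q2) // invf_le1 // ler1n.
  have hq : [series d k * (s * q) ^+ k]_k @ \oo --> (0 : C).
    by apply: hs; rewrite gtr0_norm ?mulr_gt0 // ger_pMr.
  have E0 : 0 < M * q ^+ n.+1 by rewrite mulr_gt0 // exprn_gt0.
  have [N _ hN] := (cvgr0Pnorm_le _).1 hq _ E0.
  have := hN (n.+1 + N)%N (leq_addl _ _); rewrite /series /=.
  rewrite (big_cat_nat (n := n.+1)) ?leq_addr //= big_nat_recr //=.
  rewrite big_nat big1 ?add0r; last by move=> i /= ilt; rewrite IH ?mul0r.
  set T := (X in _ + X) => hT.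
  have geo K : \sum_(n.+1 <= i < n.+1 + K) q ^+ i
                 <= 2 * q ^+ n.+1 - 2 * q ^+ (n.+1 + K).
    elim: K => [|K IHK]; first by rewrite addn0 big_geq // subrr.
    rewrite addnS big_nat_recr ?leq_addr //=.
    apply: (le_trans (lerD IHK (lexx _))).
    rewrite -addrA lerD2l exprS; set z := q ^+ _.
    have z0 : 0 <= z by rewrite exprn_ge0 ?ltW.
    rewrite [2 * z]mulr_natl mulr2n opprD addrNK lerN2 mulrA ler_piMl //.
    by rewrite mulrC -ler_pdivlMr // mul1r.
  have hT' : `|T| <= 2 * M * q ^+ n.+1.
    apply: (le_trans (ler_norm_sum _ _ _)).
    apply: (@le_trans _ _ (\sum_(n.+1 <= i < n.+1 + N) M * q ^+ i)).
      apply: ler_sum => i _; rewrite exprMn mulrA normrM.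
      by rewrite (ger0_norm (exprn_ge0 _ (ltW q0))) ler_wpM2r // exprn_ge0 ?ltW.
    rewrite -mulr_sumr mulrAC mulrC ler_wpM2r ?(ltW M0) //.
    by apply: (le_trans (geo _)); rewrite gerBl mulr_ge0 // exprn_ge0 ?ltW.
  have : `|d n * s ^+ n| * q ^+ n <= 3 * M * q * q ^+ n.
    rewrite -[in leLHS](ger0_norm (exprn_ge0 n (ltW q0))) -normrM.
    rewrite -[d n * _ * _]mulrA -[s ^+ n * _]exprMn.
    rewrite -[d n * _](addrK T) (le_trans (ler_normB _ _)) //.
    rewrite (le_trans (lerD hT hT')) // -!mulrA -exprS -{1}[M * _]mul1r -mulrDl.
    by rewrite -(natrD _ 1 2).
  by rewrite ler_pM2r // exprn_gt0.
have /eqP : d n * s ^+ n = 0.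
  apply: normr0_eq0; apply/eqP/negPn/negP => y_neq0.
  set y := `|_| in y_neq0 main.
  have y0 : 0 < y by rewrite lt_def y_neq0 normr_ge0.
  have c0 : 0 < (3 * M + y) * 2 by rewrite mulr_gt0 // addr_gt0 // mulr_gt0.
  have := main (y / ((3 * M + y) * 2)); rewrite divr_gt0 // => /(_ isT).
  rewrite ler_pdivrMr // mulrCA mulVf ?pnatr_eq0 // mulr1 lerDr.
  rewrite (ltW (mulr_gt0 _ M0)) // => /(_ isT).
  rewrite mulrA ler_pdivlMr // mulrC ler_pM2r // mulrDl [3 * M * 2]mulr_natr.
  by rewrite mulr2n -addrA gerDl lt_geF // addr_gt0 // mulr_gt0.
by rewrite mulf_eq0 expf_eq0 (gt_eqF s0) andbF orbF => /eqP.
Unshelve. all: by end_near.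
Qed.

Lemma taylor_coefE (C : numFieldType) (f : C -> C) (a : nat -> C) :
  power_expansion0 f a -> taylor_coef f = a.
Proof.
move=> fa; rewrite /taylor_coef; apply/funext => n; case: xgetP => [b _ fb|H].
  by rewrite (power_expansion0_unique fb fa).
by case: (H a).
Qed.

(* Main.v *)
(* Put w(l) = prod_k (1 - x_k^l)^(s_k) and e_n = E[Z_n].  Both e and the      *)

(* det(1 - x g) is the product of 1 - x^l over the cycle lengths l of g, so Z_n is the product of
   the w(l). The cycle of a given point of n + 1 has uniform length and leaves a uniform permutation
   of the other points, whence the recurrence for e ([marked_sum_unroll], [expect_recurrence]). By
   the binomial theorem w(l) is also the coefficient of t^l in t f'/f ([fgen_logder]).
   [logder_unique] concludes, as [taylor_coefE] identifies the convergent expansion. *)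
(* Taylor coefficients a of f satisfy c_0 = 1 and                             *)
(*   (n + 1) c_(n+1) = sum_(l <= n) w(l + 1) c_(n-l),                         *)
(* which has a single solution.                                               *)
(* For a, this is t f' = f * sum_(l >= 1) w(l) t^l; it is checked, together   *)
(* with convergence, as the factors (1 - x^k t)^(+-1) are added one by one:   *)
(* each of them adds the sequence -+ (x^k)^l to w.                            *)
(* For e, give the point 0 the weight x^(j+1) instead of x in det(1 - x g).   *)
(* If 0 is fixed by g, its factor 1 - x^(j+1) splits off; otherwise removing 0*)
(* from its cycle (a Schur complement) leaves a permutation of n - 1 points   *)
(* in which the neighbour of 0 carries the weight x^(j+2).  Iterating removes *)
(* the cycle of 0 point by point, which yields the recurrence.                *)
Require Import Defs.
From mathcomp Require Import all_boot all_order all_algebra all_fingroup.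
From mathcomp Require Import all_classical all_reals all_analysis.
From mathcomp Require Import complex.
From mathcomp Require Import ring.
Set Implicit Arguments.
Unset Strict Implicit.
Unset Printing Implicit Defensive.
Import Order.TTheory GRing.Theory Num.Theory.
Import numFieldNormedType.Exports.
Local Open Scope classical_set_scope.
Local Open Scope ring_scope.

(** * Coefficient recurrences under factors 1 - c t *)

(* [w l] is the coefficient of t^l (l > 0) in t F'/F, where F is the formal   *)
(* series with coefficients [a]; the value [w 0] is irrelevant.               *)
Definition logder (C : numFieldType) (w a : nat -> C) : Prop :=
  a 0 = 1 /\
  forall n, n.+1%:R * a n.+1 = \sum_(l < n.+1) w l.+1 * a (n - l)%N.

Lemma logder_unique (C : numFieldType) (w a b : nat -> C) :
  logder w a -> logder w b -> a = b.
Proof.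
move=> [a0 aS] [b0 bS]; apply/funext; elim/ltn_ind => -[|n] IH.
  by rewrite a0 b0.
apply: (@mulfI _ n.+1%:R); first by rewrite pnatr_eq0.
rewrite aS bS; apply: eq_bigr => l _.
by rewrite IH // ltnS leq_subr.
Qed.

(* The relation between [a] and [b] is a(t) = (1 - c t) b(t).                 *)
Lemma logder_mul (C : numFieldType) (c : C) (w a b : nat -> C) :
  b 0 = a 0 -> (forall n, b n.+1 = c * b n + a n.+1) ->
  logder w b -> logder (fun l => w l - c ^+ l) a.
Proof.
move=> ba0 ba [b0 bS]; split=> [|n]; first by rewrite -ba0.
have aE k : a k.+1 = b k.+1 - c * b k by rewrite ba addrC addKr.
(* Coefficientwise: c t / (1 - c t) times a(t) is c t b(t). *)
have tele m : \sum_(l < m.+1) c ^+ l.+1 * a (m - l)%N = c * b m.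
  elim: m => [|m IHm]; first by rewrite big_ord1 subnn expr1 ba0.
  rewrite big_ord_recl subn0 expr1.
  under eq_bigr do rewrite lift0 subSS exprS -mulrA.
  by rewrite -mulr_sumr IHm aE mulrBr addrNK.
under eq_bigr do rewrite mulrBl.
rewrite sumrB tele aE mulrBr bS.
case: n => [|n]; first by rewrite !big_ord1 subnn ba0 mul1r.
rewrite big_ord_recr [in RHS]big_ord_recr /= subnn -ba0.
have -> : \sum_(i < n.+1) w i.+1 * a (n.+1 - i)%N =
    \sum_(i < n.+1) w i.+1 * b (n.+1 - i)%N - c * (n.+1%:R * b n.+1).
  rewrite bS mulr_sumr -sumrB; apply: eq_bigr => i _.
  by have := ltn_ord i; rewrite ltnS => /subSn ->; rewrite aE mulrBr mulrCA.
by rewrite -[n.+2]addn1 natrD; ring.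
Qed.

(** The factor 1 / (1 - c t) has t F'/F = sum_(l >= 1) c^l t^l. In the induction, the surplus c
    b_(n+1) from splitting n + 2 is the l = 0 term of the new sum. *)
Lemma logder_div (C : numFieldType) (c : C) (w a b : nat -> C) :
  b 0 = a 0 -> (forall n, b n.+1 = c * b n + a n.+1) ->
  logder w a -> logder (fun l => w l + c ^+ l) b.
Proof.
move=> ba0 ba [a0 aS]; split=> [|n]; first by rewrite ba0.
elim: n => [|n IHn].
  by rewrite !big_ord1 subnn ba mulrDr aS big_ord1 subnn ba0; ring.
rewrite ba mulrDr aS.
rewrite -[in X in X + _]addn1 natrD mulrDl mul1r [_ * (c * _)]mulrCA IHn.
under [in RHS]eq_bigr do rewrite mulrDl.
rewrite big_split /= [X in _ = _ + X]big_ord_recl /= subn0 expr1.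
rewrite [X in _ + X = _]big_ord_recr [X in _ = X + _]big_ord_recr /= subnn.
rewrite ba0.
under [X in _ = _ + (_ + X)]eq_bigr
  do rewrite /bump leq0n add1n subSS exprS -mulrA.
rewrite -mulr_sumr.
have -> : \sum_(i < n.+1) w i.+1 * b (n.+1 - i)%N =
    \sum_(i < n.+1) w i.+1 * a (n.+1 - i)%N
    + c * \sum_(i < n.+1) w i.+1 * b (n - i)%N.
  rewrite mulr_sumr -big_split; apply: eq_bigr => i _ /=.
  by have := ltn_ord i; rewrite ltnS => /subSn ->; rewrite ba; ring.
under eq_bigr do rewrite mulrDl.
by rewrite big_split /=; ring.
Qed.

(** * Convergence of power expansions under factors 1 - c t *)

(* A hypothesis rather than a structure: [R[i]] is not declared archimedean.  *)
Definition norm_archi (C : numFieldType) : Prop :=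
  forall y : C, exists m : nat, `|y| <= m%:R.

Lemma norm_archi_complex (R : realType) : norm_archi R[i].
Proof.
move=> y; rewrite normc_def; set r := Num.sqrt _.
exists (Num.Def.archi_bound r).
rewrite -(rmorph_nat (real_complex R)) lecR ltW //.
by rewrite archi_boundP // sqrtr_ge0.
Qed.

(** Applied in [power_expansion0_div] to the distance of the partial sums from their limit. The
    Archimedean hypothesis makes 2^-k [|u N|] small. *)
Lemma cvg0_contraction (C : numFieldType) (q : C) (u e : nat -> C) :
  norm_archi C ->
  `|q| <= 2^-1 -> (forall n, u n.+1 = q * u n + e n) ->
  e @ \oo --> (0 : C) -> u @ \oo --> (0 : C).
Proof.
move=> archi q2 uS e0; apply/cvgr0Pnorm_le => eps eps0.
have eps2 : 0 < eps / 2 by rewrite divr_gt0.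
have eps4 : 0 < eps / 2 / 2 by rewrite divr_gt0.
(* eps/2 is the fixed point of r -> r/2 + eps/4. *)
have [N _ hN] := (cvgr0Pnorm_le _).1 e0 _ eps4.
have uN k : `|u (N + k)%N| <= `|u N| * 2^-1 ^+ k + eps / 2.
  elim: k => [|k IHk]; first by rewrite addn0 expr0 mulr1 lerDl ltW.
  rewrite addnS uS (le_trans (ler_normD _ _)) // normrM.
  have h2 : `|q| * `|u (N + k)%N| <= 2^-1 * (`|u N| * 2^-1 ^+ k + eps / 2).
    by rewrite ler_pM.
  rewrite (le_trans (lerD h2 (hN _ (leq_addr _ _)))) // exprS.
  by rewrite -subr_ge0 (_ : _ - _ = 0) //; field.
have [m um] : exists m : nat, `|u N| <= m%:R * (eps / 2).
  have [m hm] := archi (u N / (eps / 2)).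
  exists m; rewrite -ler_pdivrMr //.
  by move: hm; rewrite normf_div (gtr0_norm eps2).
exists (N + m)%N => // n /= Nmn.
rewrite -(subnKC Nmn) -addnA (le_trans (uN _)) //.
set k := (m + _)%N.
have mk : (m%:R : C) <= 2 ^+ k.
  rewrite -natrX ler_nat (leq_trans (leq_addr (n - (N + m)) m)) //.
  by rewrite ltnW // ltn_expl.
rewrite [leRHS](splitr eps) lerD2r.
rewrite exprVn ler_pdivrMr ?exprn_gt0 // (le_trans um) // mulrC.
by rewrite ler_wpM2l // ltW.
Qed.

Lemma series_recurrence (C : numFieldType) (c t : C) (a b : nat -> C) n :
  b 0 = a 0 -> (forall n, b n.+1 = c * b n + a n.+1) ->
  [series b k * t ^+ k]_k n.+1
    = c * t * [series b k * t ^+ k]_k n + [series a k * t ^+ k]_k n.+1.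
Proof.
move=> ba0 ba; rewrite /series /=; elim: n => [|n IHn].
  by rewrite !big_nat1 big_geq // mulr0 add0r ba0.
rewrite [LHS]big_nat_recr //= [in LHS]IHn [X in _ = _ * X + _]big_nat_recr //=.
by rewrite [X in _ = _ + X]big_nat_recr //= ba exprS; ring.
Qed.

Lemma power_expansion0_mul (C : numFieldType) (c : C) (f : C -> C)
    (a b : nat -> C) :
  b 0 = a 0 -> (forall n, b n.+1 = c * b n + a n.+1) ->
  power_expansion0 f b ->
  power_expansion0 (fun t => (1 - c * t) * f t) a.
Proof.
move=> ba0 ba; apply: filterS => t bt.
rewrite -(cvg_shiftS [series a k * t ^+ k]_k).
have -> : (fun n => [series a k * t ^+ k]_k n.+1) =
   (fun n => [series b k * t ^+ k]_k n.+1)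
    - (fun n => c * t * [series b k * t ^+ k]_k n).
  apply/funext => n.
  by rewrite !fctE (series_recurrence _ _ ba0 ba) addrC addKr.
rewrite mulrBl mul1r; apply: cvgB; last by apply: cvgM bt; exact: cvg_cst.
by rewrite (cvg_shiftS [series b k * t ^+ k]_k).
Qed.

Lemma near0_normM_le (C : numFieldType) (c e : C) : 0 < e ->
  \forall t \near (0 : C), `|c * t| <= e.
Proof.
move=> e0; have c1 : 0 < `|c| + 1 by rewrite ltr_wpDl.
have : \forall t \near (0 : C), `|t| <= e / (`|c| + 1).
  by apply: nbhs0_le; rewrite divr_gt0.
apply: filterS => t; rewrite ler_pdivlMr // normrM mulrDr mulr1.
apply: le_trans.
by rewrite mulrC lerDl.
Qed.

Lemma power_expansion0_div (C : numFieldType) (c : C) (f : C -> C)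
    (a b : nat -> C) :
  norm_archi C ->
  b 0 = a 0 -> (forall n, b n.+1 = c * b n + a n.+1) ->
  power_expansion0 f a ->
  power_expansion0 (fun t => (1 - c * t)^-1 * f t) b.
Proof.
move=> archi ba0 ba fa.
have half : 0 < (2^-1 : C) by rewrite invr_gt0.
(* The bound 1/2 gives both 1 - c t != 0 and a contraction of ratio c t. *)
have h := near0_normM_le c half.
apply: filterS2 fa h => t at_ ct2.
have ct1 : 1 - c * t != 0.
  rewrite subr_eq0; apply/eqP => ct.
  by move: ct2; rewrite -ct normr1 invf_ge1 // lern1.
set L := _ * f t.
rewrite -[L](add0r L).
have -> : [series b k * t ^+ k]_k =
    (fun n => [series b k * t ^+ k]_k n - L) + cst L.
  by apply/funext => n; rewrite !fctE subrK.
apply: cvgD; last exact: cvg_cst.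
(* Since L = c t L + f t, the error obeys the recurrence of the partial sums with [f t]
   subtracted. *)
apply: (@cvg0_contraction _ (c * t) _
  (fun n => [series a k * t ^+ k]_k n.+1 - f t) archi) => //.
  move=> n; rewrite (series_recurrence _ _ ba0 ba) /L.
  by field.
rewrite -(subrr (f t)); apply: cvgB; last exact: cvg_cst.
by rewrite (cvg_shiftS [series a k * t ^+ k]_k).
Qed.

(** * Integer powers, finite products and the generating function *)

Lemma logder_mulX (C : numFieldType) (c : C) (m : nat) (f : C -> C)
    (w a : nat -> C) :
  power_expansion0 f a -> logder w a ->
  exists a', power_expansion0 (fun t => (1 - c * t) ^+ m * f t) a' /\
             logder (fun l => w l - m%:R * c ^+ l) a'.
Proof.
move=> fa wa; elim: m => [|m [a' [fa' wa']]].
  exists a; split.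
    by move: fa; congr power_expansion0; apply/funext => t; rewrite mul1r.
  by move: wa; congr logder; apply/funext => l; rewrite mul0r subr0.
pose a'' n := if n is k.+1 then a' k.+1 - c * a' k else a' 0.
have a''S k : a' k.+1 = c * a' k + a'' k.+1 by rewrite addrC subrK.
exists a''; split.
  have := power_expansion0_mul (erefl : a' 0 = a'' 0) a''S fa'.
  by congr power_expansion0; apply/funext => t; rewrite exprS mulrA.
have := logder_mul (erefl : a' 0 = a'' 0) a''S wa'.
by congr logder; apply/funext => l; rewrite -[m.+1]addn1 natrD; ring.
Qed.

Lemma logder_divX (C : numFieldType) (c : C) (m : nat) (f : C -> C)
    (w a : nat -> C) :
  norm_archi C ->
  power_expansion0 f a -> logder w a ->
  exists a', power_expansion0 (fun t => (1 - c * t) ^- m * f t) a' /\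
             logder (fun l => w l + m%:R * c ^+ l) a'.
Proof.
move=> archi fa wa; elim: m => [|m [a' [fa' wa']]].
  exists a; split.
    by move: fa; congr power_expansion0; apply/funext => t; rewrite invr1 mul1r.
  by move: wa; congr logder; apply/funext => l; rewrite mul0r addr0.
pose a'' := fix g n := if n is k.+1 then c * g k + a' k.+1 else a' 0.
have a''S k : a'' k.+1 = c * a'' k + a' k.+1 by [].
exists a''; split.
  have := power_expansion0_div archi (erefl : a'' 0 = a' 0) a''S fa'.
  by congr power_expansion0; apply/funext => t; rewrite exprS invfM mulrA.
have := logder_div (erefl : a'' 0 = a' 0) a''S wa'.
by congr logder; apply/funext => l; rewrite -[m.+1]addn1 natrD; ring.
Qed.

Lemma logder_mulXz (C : numFieldType) (c : C) (z : int) (f : C -> C)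
    (w a : nat -> C) :
  norm_archi C ->
  power_expansion0 f a -> logder w a ->
  exists a', power_expansion0 (fun t => (1 - c * t) ^ (- z) * f t) a' /\
             logder (fun l => w l + z%:~R * c ^+ l) a'.
Proof.
move=> archi fa wa; case: z => m.
  have [a' [fa' wa']] := logder_divX c m archi fa wa; exists a'; split => //.
  move: fa'; congr power_expansion0; apply/funext => t.
  by rewrite -exprnN.
have [a' [fa' wa']] := logder_mulX c m.+1 fa wa; exists a'; split.
  by move: fa'; congr power_expansion0; apply/funext => t; rewrite NegzE opprK.
move: wa'; congr logder; apply/funext => l.
by rewrite NegzE mulrNz mulNr.
Qed.

Lemma logder_prod (C : numFieldType) (I : Type) (r : seq I) (c : I -> C)
    (z : I -> int) :
  norm_archi C ->
  exists a,
    power_expansion0 (fun t => \prod_(k <- r) (1 - c k * t) ^ (- z k)) a /\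
    logder (fun l => \sum_(k <- r) (z k)%:~R * c k ^+ l) a.
Proof.
move=> archi; elim: r => [|k r [a [fa wa]]].
  exists (fun n => (n == 0%N)%:R); split.
    rewrite /power_expansion0; near=> t.
    (* The empty partial sum is 0; all later ones are 1. *)
    rewrite big_nil -(cvg_shiftS [series _]_k).
    rewrite [X in X @ _](_ : _ = cst 1); first exact: cvg_cst.
    apply/funext => n; rewrite /series /= big_nat_recl //= expr0 mulr1.
    by rewrite big1 ?addr0 // => i _; rewrite mul0r.
  split=> // n; rewrite mulr0 big1 // => i _.
  by rewrite big_nil mul0r.
have [a' [fa' wa']] := logder_mulXz (c k) (z k) archi fa wa; exists a'; split.
  by move: fa'; congr power_expansion0; apply/funext => t; rewrite big_cons.
by move: wa'; congr logder; apply/funext => l; rewrite big_cons addrC.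
Unshelve. all: by end_near.
Qed.

(** Expanding each (1 - x_j^l)^(s_j) and distributing the product over j gives the sum over k of
    [signed_mbin s k] times (x^k)^l. *)
Lemma fgen_logder (C : numFieldType) (p : nat) (s : 'I_p -> nat)
    (x : 'I_p -> C) :
  norm_archi C ->
  exists a, power_expansion0 (fgen s x) a /\
    logder (fun l => \prod_(k < p) (1 - x k ^+ l) ^+ s k) a.
Proof.
(* Exponents k with some k j >= M contribute the factor 1, so k may range over the finite type of
   maps into ['I_M]. *)
move=> archi; pose M := (\max_(j < p) s j).+1.
pose emb (g : {ffun 'I_p -> 'I_M}) : {ffun 'I_p -> nat} :=
  [ffun j => val (g j)].
have emb_inj : injective emb.
  move=> g h /ffunP gh; apply/ffunP => j; apply: val_inj.
  by have := gh j; rewrite !ffunE.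
pose r := map emb (index_enum {ffun 'I_p -> 'I_M}).
have [a [fa wa]] := logder_prod r (mpow x) (signed_mbin s) archi.
exists a; split.
  move: fa; congr power_expansion0; apply/funext => t; rewrite /fgen.
  rewrite [RHS](fsbigE r) //=.
  - by apply: eq_bigl => i; rewrite in_setT.
  - by rewrite map_inj_uniq // index_enum_uniq.
  move=> k _ kr.
  have [/forallP ks|] := boolP [forall j, k j <= s j]%N.
    have kM j : (k j < M)%N by rewrite ltnS (leq_trans (ks j)) // leq_bigmax.
    case/negP: kr; apply/mapP; exists [ffun j => Ordinal (kM j)].
      by rewrite mem_index_enum.
    by apply/ffunP => j; rewrite !ffunE.
  rewrite negb_forall => /existsP[j]; rewrite -ltnNge => sk.
  rewrite /signed_mbin (bigD1 j) //= bin_small // !mul0r oppr0.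
  by rewrite expr0z.
move: wa; congr logder; apply/funext => l.
rewrite big_map /=.
transitivity (\prod_(j < p) \sum_(i < M)
    'C(s j, i)%:R * (-1) ^+ i * x j ^+ (i * l)).
  rewrite bigA_distr_bigA /=; apply: eq_bigr => g _.
  rewrite /signed_mbin /mpow rmorph_prod -prodrXl -big_split /=.
  apply: eq_bigr => j _; rewrite ffunE exprM; congr (_ * _).
  by rewrite rmorphM rmorphXn rmorphN1.
apply: eq_bigr => j _.
rewrite exprBn.
have sM : ((s j).+1 <= M)%N by rewrite ltnS leq_bigmax.
rewrite [RHS](big_ord_widen _ (fun i =>
  (-1) ^+ i * 1 ^+ (s j - i) * (x j ^+ l) ^+ i *+ 'C(s j, i)) sM).
rewrite [RHS]big_mkcond; apply: eq_bigr => i _.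
case: ltnP => [_|si]; last by rewrite bin_small // !mul0r.
by rewrite expr1n mulr1 -exprM (mulnC l) -[RHS]mulr_natl mulrA.
Qed.

(** * Determinants of weighted permutation matrices *)

Definition weighted_mx (C : comPzRingType) (n : nat) (d : 'I_n -> C) (u : 'S_n)
    : 'M[C]_n :=
  \matrix_(i < n, j < n) ((i == j)%:R - d i * (i == u j)%:R).

(** Relabelling the points by [t] permutes rows and columns alike, so the two signs cancel. *)
Lemma det_weighted_conj (C : comPzRingType) (n : nat) (d : 'I_n -> C)
    (u t : 'S_n) :
  \det (weighted_mx (fun i => d (t i)) (u ^ t^-1)%g) = \det (weighted_mx d u).
Proof.
have -> : weighted_mx (fun i => d (t i)) (u ^ t^-1)%g
    = row_perm t (col_perm t (weighted_mx d u)).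
  apply/matrixP => i j; rewrite !mxE (inj_eq perm_inj).
  rewrite conjgE invgK !permM; congr (_ - _ * (_ : bool)%:R).
  by rewrite -(inj_eq (@perm_inj _ t)) permKV.
rewrite row_permE col_permE !det_mulmx !det_perm odd_permV.
by rewrite mulrC -mulrA -signr_addb addbb mulr1.
Qed.

(* [tperm ord0 m] after [lift_perm ord0 ord0 u] inserts [ord0] right before   *)
(* [m] in its cycle (or as a fixed point if [m = ord0]).                      *)
Definition insert_perm (n : nat) (u : 'S_n) (m : 'I_n.+1) : 'S_n.+1 :=
  (lift_perm ord0 ord0 u * tperm ord0 m)%g.

Lemma insert_perm_bij (n : nat) :
  bijective (fun v : 'S_n * 'I_n.+1 => insert_perm v.1 v.2).
Proof.
apply: inj_card_bij.
  move=> [u m] [v m'] /= E.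
  have mm' : m = m'.
    have := congr1 (fun t : 'S_n.+1 => t ord0) E.
    by rewrite !permM !lift_perm_id !tpermL.
  subst m'; congr pair; move/mulIg: E => E.
  apply/permP => i; apply: (@lift_inj _ ord0).
  by rewrite -(lift_perm_lift ord0 ord0 u) E lift_perm_lift.
by rewrite card_prod !card_Sn card_ord factS mulnC.
Qed.

Lemma sum_insert_perm (V : nmodType) (n : nat) (F : 'S_n.+1 -> V) :
  \sum_s F s = \sum_(m < n.+1) \sum_(u : 'S_n) F (insert_perm u m).
Proof.
rewrite (reindex _ (onW_bij _ (insert_perm_bij n))) /=.
rewrite -(pair_big xpredT xpredT (fun u m => F (insert_perm u m))) /=.
exact: exchange_big.
Qed.

Lemma det_insert_ord0 (C : comPzRingType) (n : nat) (d : 'I_n.+1 -> C)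
    (u : 'S_n) :
  \det (weighted_mx d (insert_perm u ord0)) =
  (1 - d ord0) * \det (weighted_mx (fun i => d (lift ord0 i)) u).
Proof.
rewrite -[weighted_mx _ _](@submxK _ 1 n 1 n).
set A := ulsubmx _; set B := ursubmx _.
set c := dlsubmx _; set D := drsubmx _.
have -> : c = 0.
  apply/matrixP => i j; rewrite !mxE !ord1 /insert_perm tperm1 mulg1.
  rewrite lshift0 lift_perm_id.
  rewrite rshift1 !(eq_sym (lift _ _)) !(negPf (neq_lift _ _)).
  by rewrite mulr0 subr0.
rewrite (@det_ublock _ 1 n) det_mx11; congr (_ * _); last congr (\det _).
  by rewrite !mxE lshift0 /insert_perm tperm1 mulg1 lift_perm_id eqxx mulr1.
apply/matrixP => i j; rewrite !mxE /insert_perm tperm1 mulg1.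
by rewrite !rshift1 lift_perm_lift !(inj_eq lift_inj).
Qed.

Lemma det_schur1 (C : comPzRingType) (n : nat) (B : 'M[C]_(1, n))
    (c : 'M[C]_(n, 1)) (D : 'M[C]_n) :
  \det (block_mx 1%:M B c D) = \det (D - c *m B).
Proof.
have -> : block_mx 1%:M B c D =
    block_mx 1%:M 0 c 1%:M *m block_mx 1%:M B 0 (D - c *m B).
  by rewrite mulmx_block !mul1mx mulmx1 !mul0mx !addr0 addrC subrK.
by rewrite det_mulmx det_lblock det_ublock !det1 !mul1r.
Qed.

(** As 0 is not fixed, its diagonal entry is 1 and serves as pivot. The Schur complement restores
    the arrow into [m] that passed through 0, with the product of the two weights. *)
Lemma det_insert_lift (C : comPzRingType) (n : nat) (d : 'I_n.+1 -> C)
    (u : 'S_n) (m : 'I_n) :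
  \det (weighted_mx d (insert_perm u (lift ord0 m))) =
  \det (weighted_mx
    (fun i => if i == m then d (lift ord0 m) * d ord0 else d (lift ord0 i)) u).
Proof.
set v := insert_perm _ _.
have v0 : v ord0 = lift ord0 m by rewrite permM lift_perm_id tpermL.
have vS j : v (lift ord0 j) = if u j == m then ord0 else lift ord0 (u j).
  rewrite permM lift_perm_lift; case: eqP => [->|/eqP ujm].
    by rewrite tpermR.
  by rewrite tpermD ?(inj_eq lift_inj) ?neq_lift // eq_sym.
rewrite -[weighted_mx _ v](@submxK _ 1 n 1 n).
have -> : @ulsubmx _ 1 n 1 n (weighted_mx d v) = 1%:M.
  apply/matrixP => i j; rewrite !mxE !ord1 lshift0 v0.
  by rewrite (negPf (neq_lift _ _)) mulr0 subr0.
rewrite det_schur1; congr (\det _).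
apply/matrixP => i j; rewrite !mxE big_ord1 !mxE lshift0 !rshift1 v0 vS.
rewrite !(inj_eq lift_inj) !(eq_sym (lift _ _) ord0) !(negPf (neq_lift _ _)).
have [->|ujm] := eqVneq (u j) m; rewrite ?eqxx.
  rewrite (eq_sym (lift _ _) ord0) (negPf (neq_lift _ _)).
  by have [->|im] := eqVneq i m; rewrite /=; ring.
rewrite (inj_eq lift_inj) (negPf (neq_lift _ _)).
have [->|im] := eqVneq i m; rewrite /=; last by ring.
by rewrite (eq_sym m (u j)) (negPf ujm) !(mulr0, subr0).
Qed.

(** * Sums with a marked point and the recurrence for the expectation *)

(** The point [m] stands for itself and j points already removed from its cycle. *)
Definition marked (C : pzSemiRingType) (j n : nat) (m : 'I_n)
    (y : C) (i : 'I_n) : C :=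
  y ^+ (if i == m then j.+1 else 1).

Definition marked_sum (C : comPzRingType) (p : nat) (s : 'I_p -> nat)
    (x : 'I_p -> C) (n : nat) (j : nat) (m : 'I_n) : C :=
  \sum_(u : 'S_n)
    \prod_(k < p) \det (weighted_mx (marked j m (x k)) u) ^+ s k.

Lemma marked_sum_indep (C : comPzRingType) (p : nat) (s : 'I_p -> nat)
    (x : 'I_p -> C) (n : nat) (j : nat) (m m' : 'I_n) :
  marked_sum s x j m = marked_sum s x j m'.
Proof.
rewrite /marked_sum (reindex_inj (@conjg_inj _ (tperm m m'))) /=.
apply: eq_bigr => u _; apply: eq_bigr => k _; congr (_ ^+ _).
rewrite -[RHS](det_weighted_conj _ _ (tperm m m')) tpermV.
congr (\det (weighted_mx _ _)); apply/funext => i.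
by rewrite /marked -{2}(tpermL m m') (inj_eq perm_inj).
Qed.

(** Split by the image of 0: if fixed, its cycle is complete with total length j + 1; otherwise its
    weight merges into that of its image [m]. *)
Lemma marked_sumS (C : numFieldType) (p : nat) (s : 'I_p -> nat)
    (x : 'I_p -> C) (n : nat) (j : nat) :
  marked_sum s x j (@ord0 n) =
  (\prod_(k < p) (1 - x k ^+ j.+1) ^+ s k) *
    (\sum_(u : 'S_n) Zprod s x u)
  + \sum_(m < n) marked_sum s x j.+1 m.
Proof.
rewrite /marked_sum sum_insert_perm big_ord_recl mulr_sumr; congr (_ + _).
  apply: eq_bigr => u _; rewrite /Zprod -big_split; apply: eq_bigr => k _ /=.
  rewrite -exprMn det_insert_ord0 {1}/marked eqxx; congr ((_ * \det _) ^+ _).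
  apply/matrixP => i l; rewrite !mxE /marked.
  by rewrite (eq_sym (lift _ _)) (negPf (neq_lift _ _)) expr1.
apply: eq_bigr => m _; apply: eq_bigr => u _; apply: eq_bigr => k _.
congr (_ ^+ _); rewrite det_insert_lift; congr (\det (weighted_mx _ _)).
apply/funext => i; rewrite /marked eqxx !(eq_sym (lift _ _) ord0).
by rewrite !(negPf (neq_lift _ _)) expr1 -exprS; case: eqP.
Qed.

Lemma sum_Zprod_marked (C : numFieldType) (p : nat) (s : 'I_p -> nat)
    (x : 'I_p -> C) (n : nat) :
  \sum_(u : 'S_n.+1) Zprod s x u = marked_sum s x 0 (@ord0 n).
Proof.
apply: eq_bigr => u _; apply: eq_bigr => k _; congr (\det _ ^+ _).
by apply/matrixP => i l; rewrite !mxE /marked if_same expr1.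
Qed.

(** The sum runs over (n + 1)! permutations but is divided by n!: by [marked_sum_indep] the n
    choices of the next marked point contribute equally, and n / n! = 1 / (n - 1)! restores the same
    form. *)
Lemma marked_sum_unroll (C : numFieldType) (p : nat) (s : 'I_p -> nat)
    (x : 'I_p -> C) (n : nat) (j : nat) :
  marked_sum s x j (@ord0 n) / n`!%:R =
  \sum_(l < n.+1) (\prod_(k < p) (1 - x k ^+ (j + l.+1)) ^+ s k) *
    expect_Sn (Zprod s x (n := n - l)).
Proof.
have expectE m : expect_Sn (Zprod s x (n := m))
    = (\sum_(u : 'S_m) Zprod s x u) / m`!%:R.
  by rewrite /expect_Sn card_Sn.
elim: n j => [|n IHn] j;
  rewrite marked_sumS mulrDl [in RHS]big_ord_recl /= addn1.
  by rewrite !big_ord0 mul0r expectE mulrA.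
rewrite subn0 expectE mulrA; congr (_ + _).
under eq_bigr do rewrite (marked_sum_indep s x j.+1 _ ord0).
rewrite sumr_const card_ord -[marked_sum _ _ _ _ *+ _]mulr_natl.
rewrite factS natrM invfM mulrACA.
rewrite mulfV ?pnatr_eq0 // mul1r IHn.
by apply: eq_bigr => l _; rewrite /bump leq0n add1n subSS addSnnS.
Qed.

Lemma expect_recurrence (C : numFieldType) (p : nat) (s : 'I_p -> nat)
    (x : 'I_p -> C) (n : nat) :
  n.+1%:R * expect_Sn (Zprod s x (n := n.+1)) =
  \sum_(l < n.+1) (\prod_(k < p) (1 - x k ^+ l.+1) ^+ s k) *
    expect_Sn (Zprod s x (n := n - l)).
Proof.
rewrite -(marked_sum_unroll s x n 0) -sum_Zprod_marked /expect_Sn card_Sn.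
by rewrite factS natrM invfM [LHS]mulrCA mulVKf ?pnatr_eq0.
Qed.

Lemma expect_Zprod0 (C : numFieldType) (p : nat) (s : 'I_p -> nat)
    (x : 'I_p -> C) :
  expect_Sn (Zprod s x (n := 0)) = 1.
Proof.
rewrite /expect_Sn (eq_bigr (fun=> 1)) => [|u _].
  by rewrite sumr_const card_Sn divr1.
by rewrite /Zprod big1 // => k _; rewrite det_mx00 expr1n.
Qed.

Theorem theorem2p12 (R : realType) (p : nat) (hp : (1 <= p)%N)
    (s : 'I_p -> nat) (x : 'I_p -> R[i]) (n : nat) :
  expect_Sn (Zprod s x (n := n)) = taylor_coef (fgen s x) n.
Proof.
have [a [fa wa]] := fgen_logder s x (@norm_archi_complex R).
rewrite (taylor_coefE fa).
suff <- : (fun m => expect_Sn (Zprod s x (n := m))) = a by [].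
apply: logder_unique wa; split; last exact: expect_recurrence.
exact: expect_Zprod0.
Qed.
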